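(* Let $n,m,d\in\mathbb{N}$, let $\Delta_{n-1}=\{\mathbf{x}\in\mathbb{R}^n_+:x_1+\dots+x_n=1\}$, let $f_0,f_1,\dots,f_m\in\mathbb{R}[\mathbf{x}]$ be homogeneous of degree $d$, let $b_1,\dots,b_m\in\mathbb{R}$, and assume the generalized moment problem \[ \mathrm{val}=\inf_{\mu\in\mathcal{M}(\Delta_{n-1})_+}\int_{\Delta_{n-1}} f_0\,\mathrm{d}\mu\quad\text{s.t.}\quad \int_{\Delta_{n-1}} f_i\,\mathrm{d}\mu=b_i\ (i\in[m]),\quad \int_{\Delta_{n-1}}\mathrm{d}\mu\le 1 \] is feasible. Assume its dual \[ \sup_{(y,t)\in\mathbb{R}^m\times\mathbb{R}_+}\ \sum_{i=1}^m y_ib_i-t\quad\text{s.t.}\quad f_0(\mathbf{x})-\sum_{i=1}^m y_if_i(\mathbf{x})+t\ge 0\ \ \forall\,\mathbf{x}\in \Delta_{n-1} \] has an optimal solution $(\bar y,t)$. Let $f_{m+1}:=1$ (the constant polynomial), $\bar y_{m+1}:=-t$, $y_0:=1$ and $y_i:=-\bar y_i$ for $i\in[m+1]$. Then for every integer $r>d(d-1)/2+1$, \[ 0\le \mathrm{val}-\underline{f}_{\mathrm{LP}}^{(r)}\le \frac{\Big(\sum_{i=0}^{m+1}B(y_if_i)+t\Big)\,d(d-1)}{2(r-1)-d(d-1)}, \] where $\underline{f}_{\mathrm{LP}}^{(r)}$ is the optimal value of the linear program \[ \underline{f}_{\mathrm{LP}}^{(r)}=\min\ L^{(r)}(f_0)\quad\text{s.t.}\quad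 L^{(r)}(f_i)=b_i\ (i\in[m]),\quad L^{(r)}(1)\le 1,\quad L^{(r)}(\mathbf{x}^\alpha)\ge 0\ (|\alpha|\le r),\quad L^{(r)}(\mathbf{x}^\alpha)=L^{(r)}\Big(\mathbf{x}^\alpha\sum_{i=1}^n x_i\Big)\ (|\alpha|\le r-1), \] over linear functionals $L^{(r)}:\mathbb{R}[\mathbf{x}]_r\to\mathbb{R}$.
   Context: $\mathcal{M}(\Delta_{n-1})_+$ is the cone of positive finite Borel measures supported on $\Delta_{n-1}$; $\mathbb{R}[\mathbf{x}]_r$ is the space of real polynomials in $n$ variables of degree at most $r$; $\mathbf{x}^\alpha=x_1^{\alpha_1}\cdots x_n^{\alpha_n}$, $|\alpha|=\sum_i\alpha_i$. For a homogeneous polynomial $f=\sum_{|\alpha|=e}f_\alpha\mathbf{x}^\alpha$ of degree $e$, $B(f)=\max_{|\alpha|=e}\frac{\alpha_1!\cdots\alpha_n!}{e!}f_\alpha$ (so for a constant $c$, $B(c)=c$). *)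

(* Defs.v *)
From HB Require Import structures.
From mathcomp Require Import all_boot all_order all_algebra.
From mathcomp Require Import mpoly.
From mathcomp Require Import all_classical all_reals all_analysis.

Set Implicit Arguments.
Unset Strict Implicit.
Unset Printing Implicit Defensive.

Import Order.TTheory GRing.Theory Num.Theory.
Import numFieldNormedType.Exports.

Local Open Scope classical_set_scope.
Local Open Scope ring_scope.

Section Defs.
Variables (R : realType) (n : nat).

Definition rpoly := mpoly.mpoly n R.
Definition mon := mpoly.multinom n.

Definition homogeneous (e : nat) (f : rpoly) : bool :=
  f \is mpoly.ishomog1 e (@mpoly.mdeg n).

Definition mcoef (f : rpoly) (a : mon) : R := mpoly.mcoeff a f.

Definition monX (a : mon) : rpoly := mpoly.mpolyX R a.

Definition mconst (c : R) : rpoly := mpoly.mpolyC n c.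

Definition sumX : rpoly := \sum_(i < n) mpoly.mpolyX R (mpoly.mnm1 i).

Definition Rn := 'rV[R]_n.
Definition BorelRn := g_sigma_algebraType (@open Rn).

Definition peval (f : rpoly) (x : Rn) : R := mpoly.meval (fun i => x ord0 i) f.

Definition std_simplex : set BorelRn :=
  [set x : Rn | (forall i, 0 <= x ord0 i) /\ \sum_(i < n) x ord0 i = 1].

(* B(f) for f homogeneous of degree e:
   max_{|alpha| = e} (alpha_1! ... alpha_n! / e!) f_alpha.
   The max ranges over the (finite, nonempty when n >= 1) set of monomials
   of degree e, enumerated as bounded monomials of degree < e+1; computed in
   \bar R with neutral element -oo and then converted to R. *)
Definition Bnum (e : nat) (f : rpoly) : R :=
  fine (\big[maxe/-oo%E]_(a : mpoly.bmultinom n e.+1 | mpoly.mdeg a == e)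
          (((\prod_(i < n) ((mpoly.bmnm a) i)`!)%:R / (e`!)%:R
             * mcoef f (mpoly.bmnm a))%:E)).

(* A linear functional L^(r) on R[x]_r, given by its values on the monomial
   basis {x^alpha : |alpha| <= r}, i.e. by l alpha = L^(r)(x^alpha). *)
Definition Lr (r : nat) (l : mpoly.bmultinom n r.+1 -> R) (p : rpoly) : R :=
  \sum_(a : mpoly.bmultinom n r.+1) mcoef p (mpoly.bmnm a) * l a.

End Defs.

(* Main.v *)
(* Write [D] for the dual optimum. Integration against a feasible measure is
   feasible for the LP, so fLP <= val, and it remains to show val <= D and
   D - error <= fLP.

   For val <= D, the moment vectors of atomic measures of mass at most 1 on the
   simplex form a compact convex set. A point of this set closest to the target
   either meets it, or yields a hyperplane contradicting the optimality of [D] or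
   the feasibility of the primal.

   For the LP bound, write a form of degree d as a sum over words w of length d,
   with coefficients c(w) that are at most B. For a functional invariant under
   multiplication by x_1 + ... + x_n, extending words to length r along an
   injection [d] -> [r] gives L(P) = sum_u c(u o phi) L(x_u). Averaged over all
   maps phi the coefficients are values of P on the simplex, hence nonnegative,
   so that the average over injections is at least minus the contribution of the
   few non-injective maps. *)
Require Import Defs.
From HB Require Import structures.
From mathcomp Require Import all_boot all_order all_algebra.
From mathcomp Require Import mpoly.
From mathcomp Require Import all_classical all_reals all_analysis.
From mathcomp Require Import measurable_realfun.
From mathcomp Require Import ring lra zify.

Import Order.TTheory GRing.Theory Num.Theory.
Import numFieldNormedType.Exports.

Local Open Scope classical_set_scope.
Local Open Scope ring_scope.

Set Implicit Arguments.
Unset Strict Implicit.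
Unset Printing Implicit Defensive.

(** * Words and forms *)

(* The word [w] is placed at the positions [phi]; each of the remaining positions
   takes one of the factors [\sum_i X i] and is filled freely. *)
Lemma prod_extend (A : comNzRingType) (I S T : finType) (X : I -> A)
    (phi : S -> T) (w : {ffun S -> I}) : injective phi ->
  (\prod_s X (w s)) * (\sum_i X i) ^+ (#|T| - #|S|) =
  \sum_(u : {ffun T -> I} | [forall s, u (phi s) == w s]) \prod_t X (u t).
Proof.
move=> phi_inj.
pose Q t i := [forall s, (phi s == t) ==> (w s == i)].
rewrite (eq_bigl (fun u => u \in family Q)); last first.
  move=> u; apply/forallP/familyP => [uP t|uP s].
    by apply/forallP => s; apply/implyP => /eqP <-; rewrite eq_sym.
  by have /forallP/(_ s) := uP (phi s); rewrite eqxx /= eq_sym.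
rewrite -(bigA_distr_big_dep Q (fun _ i => X i)).
rewrite (bigID (fun t => t \in phi @: S)) /=; congr (_ * _).
  rewrite big_imset /=; last by move=> s s' _ _ /phi_inj.
  rewrite (eq_bigl predT) //; apply: eq_bigr => s _.
  rewrite (big_pred1 (w s)) // => i; rewrite /Q /=.
  apply/forallP/eqP => [/(_ s)|-> s']; first by rewrite eqxx /= => /eqP.
  by apply/implyP => /eqP/phi_inj ->.
transitivity (\prod_(t | t \notin phi @: S) \sum_i X i).
  rewrite prodr_const; congr (_ ^+ _).
  rewrite -(card_imset _ phi_inj) -(cardC (mem (phi @: S))) addKn.
  by apply: eq_card => t; rewrite !inE.
apply: eq_bigr => t tP; apply: eq_bigl => i; rewrite /Q; apply/esym/forallP => s.
by apply/implyP => /eqP st; case/negP: tP; apply/imsetP; exists s.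
Qed.

(** Each word [u] on [T] extends exactly one [w], namely its restriction along [phi]. *)
Lemma sum_words_extend (A : comNzRingType) (I S T : finType) (X : I -> A)
    (c : {ffun S -> I} -> A) (phi : {ffun S -> T}) : injective phi ->
  (\sum_w c w * \prod_s X (w s)) * (\sum_i X i) ^+ (#|T| - #|S|) =
  \sum_(u : {ffun T -> I}) c [ffun s => u (phi s)] * \prod_t X (u t).
Proof.
move=> phi_inj; rewrite big_distrl /=.
under eq_bigr do rewrite -mulrA (prod_extend _ _ phi_inj) big_distrr /=.
rewrite (exchange_big_dep predT) //=; apply: eq_bigr => u _.
rewrite (big_pred1 [ffun s => u (phi s)]) // => w /=.
apply/forallP/eqP => [uw|-> s]; last by rewrite ffunE.
by apply/ffunP => s; rewrite ffunE; apply/esym/eqP.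
Qed.

(* The left side is a form evaluated at the empirical distribution of [v] when
   [y] is [#|T|^-1]. *)
Lemma sum_words_empirical (A : comNzRingType) (I S T : finType) (y : A)
    (c : {ffun S -> I} -> A) (v : {ffun T -> I}) :
  \sum_w c w * \prod_(s : S) \sum_(t | v t == w s) y =
  y ^+ #|S| * \sum_(phi : {ffun S -> T}) c [ffun s => v (phi s)].
Proof.
under eq_bigr => w _.
  rewrite (bigA_distr_big_dep (fun s t => v t == w s) (fun _ _ => y)).
  under eq_bigr do rewrite prodr_const.
  rewrite big_distrr /=; over.
rewrite (exchange_big_dep predT) //= big_distrr /=; apply: eq_bigr => phi _.
rewrite (big_pred1 [ffun s => v (phi s)]) => [|w /=]; first by rewrite mulrC.
apply/familyP/eqP => [uw|-> s]; last first.
  by change (v (phi s) == [ffun s => v (phi s)] s); rewrite ffunE.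
by apply/ffunP => s; rewrite ffunE; apply/esym/eqP/(uw s).
Qed.

(** The Parikh vector of a word: letters are counted, their order is forgotten. *)
Definition content (n : nat) (T : finType) (w : {ffun T -> 'I_n}) : mon n :=
  (\big[@mnm_add n/mnm0]_(t : T) mnm1 (w t)).

Lemma mdeg_content (n : nat) (T : finType) (w : {ffun T -> 'I_n}) :
  mdeg (content w) = #|T|.
Proof.
by rewrite /content mdeg_sum (eq_bigr (fun=> 1%N)) ?sum1_card // => t _; rewrite mdeg1.
Qed.

Lemma prod_word (R : realType) (n : nat) (T : finType) (w : {ffun T -> 'I_n}) :
  \prod_t monX R (mnm1 (w t)) = monX R (content w).
Proof. exact: mprodXE. Qed.

Lemma sumX_exp (R : realType) (n : nat) (T : finType) :
  sumX R n ^+ #|T| = \sum_(w : {ffun T -> 'I_n}) monX R (content w).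
Proof.
rewrite -prodr_const bigA_distr_bigA; apply: eq_bigr => w _; exact: prod_word.
Qed.

(** The multinomial theorem, by induction on [d]: differentiating [sumX ^+ d.+1] in a variable [i]
    with [0 < a i] multiplies the coefficient at [a] by [a i], and gives [d.+1] times
    [sumX ^+ d]. *)
Lemma mcoeff_sumX_exp (R : realType) (n d : nat) (a : mon n) : mdeg a = d ->
  mcoef (sumX R n ^+ d) a * (\prod_(i < n) (a i)`!)%:R = (d`!)%:R.
Proof.
elim: d a => [|d IHd] a ad.
  have /eqP -> : a == mnm0 by rewrite -mdeg_eq0 ad.
  rewrite expr0 /mcoef mcoeff1 eqxx mul1r.
  by rewrite big1 // => i _; rewrite mnm0E.
have [i ai] : exists i : 'I_n, (0 < a i)%N.
  apply/existsP; apply: contra_eqT ad => /existsPn a0.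
  by rewrite mdegE big1 // => i _; apply/eqP; rewrite -leqn0 leqNgt a0.
pose a' := mnm_sub a (mnm1 i).
have aE : a = mnm_add a' (mnm1 i).
  by rewrite submK //; apply/mnm_lepP => j; rewrite mnm1E; case: eqP => // <-.
have a'd : mdeg a' = d.
  by move: ad; rewrite aE mdegD mdeg1 addn1 => -[].
have factE : (\prod_(j < n) (a j)`! = (a' i).+1 * \prod_(j < n) (a' j)`!)%N.
  rewrite (bigD1 i) //= [in RHS](bigD1 i) //= mulnA -factS; congr (_ * _)%N.
    by rewrite {1}aE mnmDE mnm1E eqxx addn1.
  by apply: eq_bigr => j /negPf ji; rewrite {1}aE mnmDE mnm1E eq_sym ji addn0.
have dsum : mderiv i (sumX R n) = 1.
  rewrite /sumX raddf_sum /= (bigD1 i) //= mderivX mnm1E eqxx.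
  have -> : mnm_sub (mnm1 i) (mnm1 i) = mnm0.
    by apply/mnmP => j; rewrite mnmBE subnn mnm0E.
  rewrite scale1r mpolyX0 big1 ?addr0 // => j /negPf ji.
  by rewrite mderivX mnm1E ji scale0r.
have dpow k : mderiv i (sumX R n ^+ k.+1) = k.+1%:R *: sumX R n ^+ k.
  elim: k => [|k IHk]; first by rewrite expr1 dsum expr0 scale1r.
  rewrite exprS mderivM dsum mul1r IHk -scalerAr -exprS.
  by rewrite -[X in X + _]scale1r -scalerDl -mulrS.
have := congr1 (mcoeff a') (dpow d).
rewrite mcoeff_deriv mcoeffZ -aE => /(congr1 ( *%R^~ (\prod_(j < n) (a' j)`!)%:R)).
rewrite -mulrA (IHd a' a'd) factS natrM => <-.
by rewrite factE natrM mulrA; congr (_ * _); rewrite mulr_natr; exact: erefl.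
Qed.

(* The Bernstein coefficient whose maximum over [mdeg a = e] is [Bnum e f]. *)
Definition bcoef (R : realType) (n e : nat) (f : rpoly R n) (a : mon n) : R :=
  (\prod_(i < n) (a i)`!)%:R / (e`!)%:R * mcoef f a.

(** A monomial [a] of degree [d] is the content of [d! / \prod_i (a i)!] words, and [bcoef] spreads
    its coefficient evenly over them. *)
Lemma homogeneous_words (R : realType) (n d : nat) (f : rpoly R n) :
  homogeneous d f ->
  f = \sum_(w : {ffun 'I_d -> 'I_n})
        bcoef d f (content w) *: monX R (content w).
Proof.
move=> fd; apply/mpolyP => a; rewrite raddf_sum /=.
have [ad|ad] := eqVneq (mdeg a) d; last first.
  rewrite (dhomog_nemf_coeff fd ad) big1 // => w _.
  rewrite mcoeffZ mcoeffX; case: eqP => [wa|_]; last by rewrite mulr0.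
  by move: ad; rewrite -wa mdeg_content card_ord eqxx.
under eq_bigr do rewrite mcoeffZ mcoeffX.
transitivity (bcoef d f a * mcoef (sumX R n ^+ d) a).
  rewrite /bcoef mulrAC [X in X * mcoef f a]mulrAC [X in X / _ * _]mulrC.
  rewrite mcoeff_sumX_exp // divff ?mul1r // pnatr_eq0 -lt0n; exact: fact_gt0.
have := sumX_exp R n 'I_d; rewrite card_ord => ->.
rewrite /mcoef raddf_sum /= big_distrr /=; apply: eq_bigr => w _.
by rewrite mcoeffX; case: eqP => [->//|_]; rewrite !mulr0.
Qed.

(** * Lower bound for the linear program *)

Section LrTheory.
Variables (R : realType) (n r : nat) (l : mpoly.bmultinom n r.+1 -> R).

Lemma LrD (p q : rpoly R n) : Lr l (p + q) = Lr l p + Lr l q.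
Proof.
by rewrite /Lr -big_split; apply: eq_bigr => a _; rewrite /mcoef mcoeffD mulrDl.
Qed.

Lemma LrZ c (p : rpoly R n) : Lr l (c *: p) = c * Lr l p.
Proof.
by rewrite /Lr big_distrr /=; apply: eq_bigr => a _; rewrite /mcoef mcoeffZ mulrA.
Qed.

Lemma Lr0 : Lr l 0 = 0.
Proof. by rewrite -[0 in LHS](scale0r 0) LrZ mul0r. Qed.

Lemma Lr_sum (I : Type) (s : seq I) (P : pred I) (F : I -> rpoly R n) :
  Lr l (\sum_(i <- s | P i) F i) = \sum_(i <- s | P i) Lr l (F i).
Proof. exact: (big_morph _ LrD Lr0). Qed.

Hypothesis l_shift : forall a : mon n, (mdeg a <= r - 1)%N ->
  Lr l (monX R a) = Lr l (monX R a * sumX R n).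

(** Since [msize] exceeds the degree by one, the bound keeps every monomial of [p] within the range
    of [l_shift]. *)
Lemma Lr_mul_sumX (p : rpoly R n) : (msize p <= r)%N ->
  Lr l (p * sumX R n) = Lr l p.
Proof.
move=> pr; rewrite [in RHS](mpolyE p) [in LHS](mpolyE p) big_distrl !Lr_sum /=.
rewrite !big_seq; apply: eq_bigr => a /msize_mdeg_lt ap.
rewrite -scalerAl !LrZ; congr (_ * _); rewrite -l_shift //.
by have := leq_trans ap pr; lia.
Qed.

Lemma Lr_mul_sumX_exp (p : rpoly R n) k : (msize p + k <= r.+1)%N ->
  Lr l (p * sumX R n ^+ k) = Lr l p.
Proof.
elim: k p => [|k IHk] p pk; first by rewrite expr0 mulr1.
have pr : (msize p <= r)%N by lia.
rewrite exprS mulrA IHk ?Lr_mul_sumX //.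
have [->|p0] := eqVneq p 0; first by rewrite mul0r msize0; lia.
have [->|s0] := eqVneq (sumX R n) 0; first by rewrite mulr0 msize0; lia.
have s2 : (msize (sumX R n) <= 2)%N.
  apply: leq_trans (msize_sum _ _ _) _; apply/bigmax_leqP => i _.
  by rewrite msizeX mdeg1.
rewrite msizeM //; move: pk s2.
move: (mmeasure mdeg p) (mmeasure mdeg (sumX R n)) => a b.
lia.
Qed.

Lemma peval_words (d : nat) (c : {ffun 'I_d -> 'I_n} -> R) (x : Rn R n) :
  peval (\sum_w c w *: monX R (content w)) x =
  \sum_w c w * \prod_s x ord0 (w s).
Proof.
rewrite /peval raddf_sum; apply: eq_bigr => w _ /=.
rewrite mevalZ -prod_word rmorph_prod; congr (_ * _).
by apply: eq_bigr => s _; rewrite /= /monX mevalXU.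
Qed.

Lemma peval_sumX (x : Rn R n) : peval (sumX R n) x = \sum_i x ord0 i.
Proof. by rewrite /peval raddf_sum; apply: eq_bigr => i _ /=; rewrite mevalXU. Qed.

(** Up to the factor [r ^ d], this is the value of the form at the letter frequencies of [u], a
    point of the simplex. *)
Lemma sum_words_ge0 (d : nat) (c : {ffun 'I_d -> 'I_n} -> R)
    (u : {ffun 'I_r -> 'I_n}) : (0 < r)%N ->
  (forall x, std_simplex x -> 0 <= peval (\sum_w c w *: monX R (content w)) x) ->
  0 <= \sum_(phi : {ffun 'I_d -> 'I_r}) c [ffun s => u (phi s)].
Proof.
move=> r0 P_ge0; pose x : Rn R n := \row_i \sum_(t | u t == i) r%:R^-1.
have r0' : 0 < r%:R :> R by rewrite ltr0n.
have : 0 <= peval (\sum_w c w *: monX R (content w)) x.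
  apply: P_ge0; split=> [i|].
    by rewrite mxE sumr_ge0 // => t _; rewrite invr_ge0.
  under eq_bigr do rewrite mxE.
  rewrite (exchange_big_dep predT) //=.
  rewrite (eq_bigr (fun=> r%:R^-1)) => [|t _]; last first.
    by rewrite (big_pred1 (u t)) // => i; rewrite eq_sym.
  by rewrite sumr_const card_ord -[LHS]mulr_natr mulVf ?gt_eqF.
rewrite peval_words.
under eq_bigr do under eq_bigr do rewrite mxE.
by rewrite sum_words_empirical pmulr_rge0 // exprn_gt0 // invr_gt0.
Qed.

(** Multiplying by [sumX ^+ (r - d)] is harmless by invariance, and the positions [phi] of the
    original letters can then be chosen at will; this freedom is what allows averaging. *)
Lemma Lr_words_inj (d : nat) (c : {ffun 'I_d -> 'I_n} -> R)
    (phi : {ffun 'I_d -> 'I_r}) : (d <= r)%N -> injective phi ->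
  Lr l (\sum_w c w *: monX R (content w)) =
  \sum_(u : {ffun 'I_r -> 'I_n})
    c [ffun s => u (phi s)] * Lr l (monX R (content u)).
Proof.
move=> dr phi_inj; rewrite -(@Lr_mul_sumX_exp _ (r - d)); last first.
  rewrite -(leq_add2r d) -addnA subnK // addSn addnC -addnS leq_add2l.
  apply: leq_trans (msize_sum _ _ _) _; apply/bigmax_leqP => w _.
  apply: leq_trans (msizeZ_le _ _) _.
  by rewrite msizeX mdeg_content card_ord.
have := @sum_words_extend _ _ _ _ (fun i => monX R (mnm1 i))
  (fun w => (c w)%:MP) phi phi_inj.
rewrite !card_ord => E.
under eq_bigr => w _ do rewrite -mul_mpolyC -prod_word.
rewrite E Lr_sum; apply: eq_bigr => u _.
by rewrite prod_word mul_mpolyC LrZ.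
Qed.

(* Polya's estimate: average [Lr_words_inj] over the injections [phi]; by
   [sum_words_ge0] the sum over injections is at least minus the sum over the
   non-injective maps, and there are [r ^ d - r ^_ d] of those. *)
Lemma Lr_ge_words (d : nat) (c : {ffun 'I_d -> 'I_n} -> R) (B : R) :
  let P := \sum_w c w *: monX R (content w) in
  (0 < n)%N -> (0 < r)%N -> (d <= r)%N ->
  (forall a : mon n, (mdeg a <= r)%N -> 0 <= Lr l (monX R a)) ->
  (forall x, std_simplex x -> 0 <= peval P x) ->
  (forall w, c w <= B) ->
  0 <= B /\
  - (B * ((r ^ d)%N%:R - (r ^_ d)%N%:R)) * Lr l (mconst n 1) <=
    (r ^_ d)%N%:R * Lr l P.
Proof.
move=> P n0 r0 dr l_ge0 P_ge0 cB.
have sum_ge0 := fun u => @sum_words_ge0 d c u r0 P_ge0.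
pose inj := [set phi : {ffun 'I_d -> 'I_r} | injectiveb phi]%SET.
have card_inj : #|inj| = (r ^_ d)%N by rewrite card_inj_ffuns !card_ord.
have card_noninj : (#|(~: inj)%SET|%:R = (r ^ d)%N%:R - (r ^_ d)%N%:R :> R).
  have := cardsC inj; rewrite card_ffun !card_ord card_inj => <-.
  by rewrite natrD addrC addKr.
(* A constant word suffices: the nonnegative sum has [r ^ d] terms, each at most [B]. *)
have B0 : 0 <= B.
  pose u : {ffun 'I_r -> 'I_n} := [ffun=> Ordinal n0].
  have : 0 <= (r ^ d)%N%:R * B.
    apply: le_trans (sum_ge0 u) _.
    apply: (@le_trans _ _ (\sum_(phi : {ffun 'I_d -> 'I_r}) B)); first exact: ler_sum.
    by rewrite sumr_const card_ffun !card_ord mulr_natl.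
  by rewrite pmulr_rge0 // ltr0n expn_gt0 r0.
split=> //.
have -> : (r ^_ d)%N%:R * Lr l P =
    \sum_(u : {ffun 'I_r -> 'I_n})
       (\sum_(phi in inj) c [ffun s => u (phi s)]) * Lr l (monX R (content u)).
  under [RHS]eq_bigr do rewrite big_distrl /=.
  rewrite exchange_big /= -card_inj mulr_natl -sumr_const.
  by apply: eq_bigr => phi; rewrite inE => /injectiveP; exact: Lr_words_inj.
(* By invariance [1] and [sumX ^+ r] have the same image, so the words of length [r] share out the
   mass. *)
have -> : Lr l (mconst n 1) =
    \sum_(u : {ffun 'I_r -> 'I_n}) Lr l (monX R (content u)).
  rewrite -Lr_sum -sumX_exp card_ord -[sumX R n ^+ r]mul1r Lr_mul_sumX_exp //.
  by rewrite msize1.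
rewrite big_distrr; apply: ler_sum => u _ /=.
apply: ler_wpM2r; first by rewrite l_ge0 // mdeg_content card_ord.
have := sum_ge0 u; rewrite (bigID (mem inj)) /= -card_noninj.
suff : \sum_(phi | phi \notin inj) c [ffun s => u (phi s)] <=
       B * #|(~: inj)%SET|%:R by lra.
rewrite mulr_natr -sumr_const [leRHS](eq_bigl (fun phi => phi \notin inj)).
  exact: ler_sum.
by move=> phi; rewrite inE.
Qed.

End LrTheory.

Lemma homogeneousZ (R : realType) (n d : nat) (c : R) (f : rpoly R n) :
  homogeneous d f -> homogeneous d (c *: f).
Proof. exact: dhomogZ. Qed.

(** The conversion by [fine] is faithful only on finite values; the term of [a] itself keeps the
    maximum above [-oo]. *)
Lemma bcoef_le_Bnum (R : realType) (n e : nat) (f : rpoly R n) (a : mon n) :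
  mdeg a = e -> bcoef e f a <= Bnum e f.
Proof.
move=> ae; have ae1 : (mdeg a < e.+1)%N by rewrite ae.
rewrite /Bnum.
set F := (fun a' : mpoly.bmultinom n e.+1 => ((bcoef e f (mpoly.bmnm a'))%:E)).
have le_max : (F (BMultinom ae1) <=
    \big[maxe/-oo]_(a' : mpoly.bmultinom n e.+1 | mdeg a' == e) F a')%E.
  apply: (@le_bigmax_cond _ _ _ -oo%E _
    (fun a' : mpoly.bmultinom n e.+1 => mdeg a' == e) F).
  by rewrite /= ae.
have lt_oo : (\big[maxe/-oo]_(a' : mpoly.bmultinom n e.+1 | mdeg a' == e) F a' < +oo)%E.
  by apply/bigmax_ltP; split=> // a' _; rewrite ltry.
rewrite -lee_fin fineK //.
by rewrite fin_num_abs lte_absl lt_oo andbT (lt_le_trans _ le_max) // ltNyr.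
Qed.

(** * The Polya error term and its use in the linear program *)

Lemma mul_pred_ge0 (R : numDomainType) (d : nat) : 0 <= d%:R * (d%:R - 1) :> R.
Proof.
by case: d => [|d]; [rewrite mul0r|rewrite mulr_ge0 // -natr1 addrK].
Qed.

(** The union bound for collisions: a random map from [d] points to [r] points fails to be injective
    with probability at most [d (d - 1) / (2 r)]. *)
Lemma ffact_ge (R : realType) (r d : nat) : (d <= r)%N ->
  (r ^ d)%N%:R * (2 * r%:R - d%:R * (d%:R - 1)) <= 2 * r%:R * (r ^_ d)%N%:R :> R.
Proof.
elim: d => [|d IHd] dr; first by rewrite expn0 ffactn0 mul0r subr0 mul1r mulr1.
have {}IHd := IHd (ltnW dr).
have rdE : (r - d)%N%:R = r%:R - d%:R :> R by rewrite natrB // ltnW.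
rewrite ffactnSr expnS !natrM rdE -[d.+1%:R]natr1.
have dr' : d%:R <= r%:R :> R by rewrite ler_nat ltnW.
have := ler_wpM2r (_ : 0 <= r%:R - d%:R) IHd; rewrite subr_ge0 => /(_ dr').
have Q0 : 0 <= (r ^ d)%N%:R :> R by [].
(* Up to the factor [r ^ d], this is exactly the slack of the induction step. *)
have dd : 0 <= d%:R * (d%:R * (d%:R - 1)) :> R.
  by rewrite mulr_ge0 ?mul_pred_ge0.
have := mulr_ge0 Q0 dd.
move: (d%:R : R) (r%:R : R) ((r ^ d)%N%:R : R) ((r ^_ d)%N%:R : R) => x y Q F.
nra.
Qed.

(** The difference [d (d - 1) / 2 + 1 - d] is [(d - 1) (d - 2) / 2], nonnegative for every natural
    [d]. *)
Lemma degree_le_level (R : realType) (r d : nat) :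
  d%:R * (d%:R - 1) / 2 + 1 < r%:R :> R -> (d <= r)%N.
Proof.
move=> dr; have [->//|d0] := posnP d; have [d1|d1] := eqVneq d 1%N.
  by rewrite d1 in dr *; rewrite -(ltr_nat R); move: dr; lra.
have d2 : 2 <= d%:R :> R by rewrite ler_nat; lia.
rewrite -(ler_nat R); nra.
Qed.

Lemma level_gt0 (R : realType) (r d : nat) :
  d%:R * (d%:R - 1) / 2 + 1 < r%:R :> R -> (0 < r)%N.
Proof.
by move=> dr; rewrite -(ltr_nat R); have := mul_pred_ge0 R d; lra.
Qed.

(** With [D = d (d - 1)], [ffact_ge] bounds the ratio of non-injective to injective maps by
    [D / (2 r - D)], hence by [D / (2 (r - 1) - D)]. *)
Lemma polya_error (R : realType) (r d : nat) (B S L1 LP : R) :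
  d%:R * (d%:R - 1) / 2 + 1 < r%:R :> R ->
  0 <= B -> B <= S -> 0 <= L1 -> L1 <= 1 ->
  - (B * ((r ^ d)%N%:R - (r ^_ d)%N%:R)) * L1 <= (r ^_ d)%N%:R * LP ->
  - (S * (d%:R * (d%:R - 1)) / (2 * (r%:R - 1) - d%:R * (d%:R - 1))) <= LP.
Proof.
move=> hr B0 BS L0 L1_le1 H.
have dr := degree_le_level hr.
have F0 : 0 < (r ^_ d)%N%:R :> R by rewrite ltr0n ffact_gt0.
have FQ : (r ^_ d)%N%:R <= (r ^ d)%N%:R :> R.
  rewrite ler_nat; elim: (d) => [|k IHk]; first by rewrite ffactn0.
  by rewrite ffactnSr expnSr leq_mul // leq_subr.
have := ffact_ge R dr; move: hr H F0 FQ.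
have := mul_pred_ge0 R d.
set D := d%:R * (d%:R - 1); move: D (r%:R : R) ((r ^ d)%N%:R : R) ((r ^_ d)%N%:R : R).
move=> D y Q F D0 hr H F0 FQ HQ.
have q0 : 0 < 2 * (y - 1) - D by lra.
rewrite lerNl ler_pdivlMr //.
have H1 : - (B * (Q - F)) <= F * LP.
  apply: le_trans H; rewrite mulNr lerN2 ler_piMr // mulr_ge0 //; lra.
have H2 : (Q - F) * (2 * y - D) <= F * D by lra.
have H3 : - LP * F * (2 * y - D) <= B * (F * D).
  apply: le_trans (_ : B * (Q - F) * (2 * y - D) <= _); last first.
    by rewrite -mulrA ler_wpM2l.
  by rewrite ler_wpM2r //; lra.
have H4 : - LP * (2 * y - D) <= B * D.
  by rewrite -(ler_pM2l F0); lra.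
have SD : B * D <= S * D by rewrite ler_wpM2r.
have [LP0|LP0] := leP 0 LP.
  apply: (@le_trans _ _ 0); last by rewrite mulr_ge0 // (le_trans B0).
  by rewrite mulNr oppr_le0 mulr_ge0 // ltW.
nra.
Qed.

(** Weak duality up to an error: the dual slack is nonnegative on the simplex, so [Lr l] can be
    negative on it only by the amount that [Lr_ge_words] controls. *)
Lemma lp_lower_bound (R : realType) (n m d r : nat)
  (f0 : rpoly R n) (f : 'I_m -> rpoly R n) (b : 'I_m -> R)
  (ybar : 'I_m -> R) (t : R) (l : mpoly.bmultinom n r.+1 -> R) :
  (0 < n)%N -> homogeneous d f0 -> (forall i, homogeneous d (f i)) ->
  0 <= t ->
  (forall x : Rn R n, std_simplex x ->
     0 <= peval f0 x - \sum_(i < m) ybar i * peval (f i) x + t) ->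
  (d%:R * (d%:R - 1)) / 2 + 1 < r%:R :> R ->
  (forall i, Lr l (f i) = b i) -> Lr l (@mconst R n 1) <= 1 ->
  (forall a : mon n, (mpoly.mdeg a <= r)%N -> 0 <= Lr l (monX R a)) ->
  (forall a : mon n, (mpoly.mdeg a <= r - 1)%N ->
     Lr l (monX R a) = Lr l (monX R a * sumX R n)) ->
  \sum_(i < m) ybar i * b i - t
    - ((Bnum d f0 + \sum_(i < m) Bnum d (- ybar i *: f i)
           + Bnum 0 (@mconst R n t) + t) * (d%:R * (d%:R - 1)))
      / (2 * (r%:R - 1) - d%:R * (d%:R - 1)) <= Lr l f0.
Proof.
move=> n0 hf0 hf t0 nonneg hr lb l1 l_ge0 l_shift.
set S := _ + t.
have dr := degree_le_level hr.
have r0 := level_gt0 hr.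
pose hg i := homogeneousZ (- ybar i) (hf i).
(* The last [t] is the coefficient of every word in [t *: sumX ^+ d], the constant [t] made
   homogeneous of degree [d]. *)
pose c (w : {ffun 'I_d -> 'I_n}) := bcoef d f0 (content w) +
  \sum_(i < m) bcoef d (- ybar i *: f i) (content w) + t.
pose P := \sum_w c w *: monX R (content w).
have PE : P = f0 - \sum_(i < m) ybar i *: f i + t *: sumX R n ^+ d.
  rewrite -sumrN [in RHS](homogeneous_words hf0).
  rewrite [X in _ + X + _](eq_bigr (fun i => \sum_(w : {ffun 'I_d -> 'I_n})
    bcoef d (- ybar i *: f i) (content w) *: monX R (content w))); last first.
    by move=> i _; rewrite -homogeneous_words // scaleNr.
  rewrite exchange_big /= -[in X in t *: _ ^+ X](card_ord d) sumX_exp.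
  rewrite scaler_sumr -!big_split; apply: eq_bigr => w _ /=.
  by rewrite !scalerDl scaler_suml.
have L0 : 0 <= Lr l (@mconst R n 1).
  by rewrite /mconst mpolyC1 -mpolyX0 l_ge0 // mdeg0.
have Lsig : Lr l (sumX R n ^+ d) = Lr l (@mconst R n 1).
  by rewrite -[sumX R n ^+ d]mul1r Lr_mul_sumX_exp // msize1.
have LP : Lr l P = Lr l f0 - \sum_(i < m) ybar i * b i + t * Lr l (@mconst R n 1).
  rewrite PE !LrD -sumrN Lr_sum LrZ Lsig -sumrN; congr (_ + _ + _).
  by apply: eq_bigr => i _; rewrite -scaleNr LrZ lb mulNr.
have P_ge0 x : std_simplex x -> 0 <= peval P x.
  move=> Dx; have := nonneg x Dx; rewrite PE /peval mevalD mevalB mevalZ.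
  rewrite rmorphXn /= -/(peval (sumX R n) x) peval_sumX (proj2 Dx) expr1n mulr1.
  rewrite [X in _ -> is_true (0 <= _ - X + _)]raddf_sum /=.
  by rewrite [X in _ -> is_true (0 <= _ - X + _)]
    (eq_bigr _ (fun i _ => mevalZ _ _ _)).
pose B := Bnum d f0 + \sum_(i < m) Bnum d (- ybar i *: f i) + t.
have cB w : c w <= B.
  have cw : mdeg (content w) = d by rewrite mdeg_content card_ord.
  rewrite /c /B lerD2r lerD ?bcoef_le_Bnum //.
  by apply: ler_sum => i _; exact: bcoef_le_Bnum.
have [B0 H] := Lr_ge_words l_shift n0 r0 dr l_ge0 P_ge0 cB.
(* The difference is [Bnum 0 (mconst n t)], which is at least the coefficient [t]. *)
have BS : B <= S.
  rewrite /B /S lerD2r lerDl.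
  apply: le_trans (_ : bcoef 0 (@mconst R n t) mnm0 <= _); last first.
    by apply: bcoef_le_Bnum; rewrite mdeg0.
  by rewrite /bcoef /mcoef /mconst mcoeffC eqxx mulr1 mulr_ge0.
have := polya_error hr B0 BS L0 l1 H.
rewrite LP; have : t * Lr l (mconst n 1) <= t by rewrite ler_piMr.
set z := _ / _; move: (Lr l _) => ?; lra.
Qed.

(** * Atomic measures and strong duality *)

(** The vectors satisfy a linear relation [u] with a positive entry; subtracting from [w] the
    largest multiple of [u] that keeps it nonnegative cancels the weight at [j]. *)
Lemma conic_caratheodory (R : realFieldType) (k N : nat)
    (v : 'I_N.+1 -> 'rV[R]_k) (w : 'I_N.+1 -> R) :
  (k <= N)%N -> (forall i, 0 <= w i) ->
  exists (j : 'I_N.+1) (w' : 'I_N -> R), (forall i, 0 <= w' i) /\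
    \sum_i w' i *: v (lift j i) = \sum_i w i *: v i.
Proof.
move=> kN w0.
pose V : 'M[R]_(N.+1, k) := \matrix_i v i.
have [u uV [j0 uj0]] : exists2 u : 'rV[R]_N.+1, u *m V = 0 & exists j, 0 < u 0 j.
  have K0 : kermx V != 0.
    rewrite kermx_eq0 -row_leq_rank -ltnNge; apply: leq_ltn_trans (rank_leq_col _) _.
    by rewrite ltnS.
  have /rowV0Pn[u0 /sub_kermxP uV /rV0Pn[j uj]] := K0.
  have [uj0|uj0|/eqP] := ltgtP (u0 0 j) 0; last by rewrite (negPf uj).
    by exists (- u0); [rewrite mulNmx uV oppr0|exists j; rewrite mxE oppr_gt0].
  by exists u0 => //; exists j.
pose q j := w j / u 0 j.
pose jm := [arg min_(j < j0 | 0 < u 0 j) q j]%O.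
have [ujm qmin] : 0 < u 0 jm /\ forall j, 0 < u 0 j -> q jm <= q j.
  by rewrite /jm; case: arg_minP.
pose w'' i := w i - q jm * u 0 i.
have w''0 i : 0 <= w'' i.
  rewrite subr_ge0; have [ui|ui] := ltP 0 (u 0 i).
    by rewrite -ler_pdivlMr //; exact: qmin.
  apply: le_trans (w0 i); rewrite mulr_ge0_le0 // divr_ge0 // ltW //.
exists jm, (fun i => w'' (lift jm i)); split=> [i|]; first exact: w''0.
have sumu : \sum_i u 0 i *: v i = 0.
  rewrite -[RHS]uV mulmx_sum_row; apply: eq_bigr => i _; by rewrite rowK.
transitivity (\sum_i w'' i *: v i).
  rewrite [RHS](bigD1_ord jm) //= {2}/w'' /q divfK ?gt_eqF // subrr scale0r add0r.
  by [].
rewrite /w''; under eq_bigr do rewrite scalerBl -scalerA.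
by rewrite sumrB -scaler_sumr sumu scaler0 subr0.
Qed.

Lemma mx_entry_continuous (T : topologicalType) (p q : nat) (i : 'I_p) (j : 'I_q) :
  continuous (fun M : 'M[T]_(p, q) => M i j).
Proof.
move=> M B MB; exists (fun i' j' => if (i' == i) && (j' == j) then B else setT).
  move=> i' j'; case: ifP => [/andP[/eqP -> /eqP ->]//|_]; exact: filterT.
by move=> N /(_ i j) /=; rewrite !eqxx.
Qed.

Lemma sum_continuous (R : realType) (T : topologicalType) (I : Type)
    (s : seq I) (P : pred I) (F : I -> T -> R) :
  (forall i, continuous (F i)) -> continuous (fun x => \sum_(i <- s | P i) F i x).
Proof.
move=> Fc x; apply: cvg_big => [y|i _]; [exact: add_continuous|exact: Fc].
Qed.

Lemma ge0_of_quadratic (R : realFieldType) (a b : R) : 0 <= b ->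
  (forall s, 0 < s -> s <= 1 -> 0 <= 2 * s * a + s ^+ 2 * b) -> 0 <= a.
Proof.
move=> b0 H; rewrite leNgt; apply/negP => a0.
have ba : 0 < b - a by lra.
(* Dividing by [b - a] rather than [b] keeps [s] at most [1] and covers [b = 0]. *)
have := H (- a / (b - a)); rewrite divr_gt0 ?oppr_gt0 // ler_pdivrMr // mul1r.
have -> : 2 * (- a / (b - a)) * a + (- a / (b - a)) ^+ 2 * b
  = a ^+ 2 / (b - a) ^+ 2 * (2 * a - b) by field; rewrite gt_eqF.
move=> /(_ isT); have -> : - a <= b - a by lra.
move=> /(_ isT); rewrite leNgt pmulr_rlt0; first by lra.
by apply: divr_gt0; [rewrite expr2; nra|exact: exprn_gt0].
Qed.

(** The left side is the squared distance from [y] to the nonpositive half-line, which contains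
    [x - Num.max 0 x]. *)
Lemma sqr_max0_le (R : realDomainType) (x y : R) :
  Num.max 0 y ^+ 2 <= (Num.max 0 x + (y - x)) ^+ 2.
Proof.
case: (leP 0 y) => hy; last by rewrite expr0n sqr_ge0.
case: (leP 0 x) => hx; first by rewrite addrC subrK.
rewrite add0r !expr2; nra.
Qed.

Section AtomicDuality.
Variables (R : realType) (T : ptopologicalType) (A : set T) (m : nat).
Variables (f0 : T -> R) (f : 'I_m -> T -> R) (b : 'I_m -> R) (D : R).
Hypotheses (A_compact : compact A) (A_neq0 : A !=set0).
Hypotheses (f0_cont : continuous f0) (f_cont : forall i, continuous (f i)).

(* By Caratheodory's theorem [m.+2] atoms are enough for the moments of [1], [f0]
   and [f] to range over a convex set. *)
Let moment (p : ('rV[T]_m.+2 * 'rV[R]_m.+2)%type) (a : T -> R) :=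
  \sum_j p.2 ord0 j * a (p.1 ord0 j).

Let moment_continuous (a : T -> R) : continuous a -> continuous (moment^~ a).
Proof.
move=> ac; apply: sum_continuous => j p.
have c2 : {for p, continuous (fun q : 'rV[T]_m.+2 * 'rV[R]_m.+2 => q.2 ord0 j)}.
  exact: (@continuous_comp _ _ _ snd _ p (@cvg_snd _ _ _ _ _)
    (@mx_entry_continuous _ _ _ _ _ _)).
have c1 : {for p, continuous (fun q : 'rV[T]_m.+2 * 'rV[R]_m.+2 => q.1 ord0 j)}.
  exact: (@continuous_comp _ _ _ fst _ p (@cvg_fst _ _ _ _ _)
    (@mx_entry_continuous _ _ _ _ _ _)).
exact: (continuousM c2 (continuous_comp c1 (ac _))).
Qed.

(** Measures are encoded by atoms and weights, so that compactness comes from a product of copies of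
    [A] and of [[0, 1]], cut by a closed condition. *)
Let K : set ('rV[T]_m.+2 * 'rV[R]_m.+2)%type :=
  ([set x : 'rV[T]_m.+2 | forall j, A (x ord0 j)] `*`
   [set w : 'rV[R]_m.+2 | forall j, `[0, 1]%classic (w ord0 j)])
  `&` (moment^~ (cst 1)) @^-1` [set x | x <= 1].

Let K_compact : compact K.
Proof.
apply: compact_closedI.
  apply: compact_setX.
    exact: (@rV_compact _ _ (fun=> A)).
  by apply: (@rV_compact R _ (fun=> `[0, 1]%classic)) => j; exact: segment_compact.
apply: preimage_closed; last exact: closed_le.
move=> p _; apply: moment_continuous => x; exact: cvg_cst.
Qed.

Let K_neq0 : K !=set0.
Proof.
have [x Ax] := A_neq0; exists (const_mx x, 0); split=> /=.
  by split=> j; rewrite mxE //= in_itv /= lexx ler01.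
by rewrite /moment big1 ?ler01 // => j _; rewrite mxE mul0r.
Qed.

(** The leading constant [1] makes the total mass one of the preserved coordinates. *)
Let coords (x : T) : 'rV[R]_m.+2 :=
  \row_i if unlift ord0 i is Some j then
           if unlift ord0 j is Some k then f k x else f0 x
         else 1.

(** Mixing [p] with a point mass at [x] gives [m.+3] atoms; [conic_caratheodory] in dimension [m.+2]
    removes one of them. *)
Let K_segment (p : ('rV[T]_m.+2 * 'rV[R]_m.+2)%type) (x : T) (s : R) :
  K p -> A x -> 0 < s -> s <= 1 ->
  exists2 q, K q &
    moment q f0 = (1 - s) * moment p f0 + s * f0 x /\
    forall i, moment q (f i) = (1 - s) * moment p (f i) + s * f i x.
Proof.
move=> [[pA pw] p1] Ax s0 s1.
pose y (i : 'I_m.+3) := if unlift ord0 i is Some j then p.1 ord0 j else x.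
pose w (i : 'I_m.+3) := if unlift ord0 i is Some j then (1 - s) * p.2 ord0 j else s.
have w0 i : 0 <= w i.
  rewrite /w; case: unliftP => [j _|_]; last exact: ltW.
  have := pw j; rewrite /= in_itv /= => /andP[pj0 _].
  by rewrite mulr_ge0 // subr_ge0.
have yA i : A (y i).
  by rewrite /y; case: unliftP.
have [j0 [w' [w'0 w'E]]] := conic_caratheodory (fun i => coords (y i)) (leqnn _) w0.
pose q : ('rV[T]_m.+2 * 'rV[R]_m.+2)%type := (\row_j y (lift j0 j), \row_j w' j).
have momentE (c : 'I_m.+2) (a : T -> R) : (forall z, coords z ord0 c = a z) ->
    moment q a = (1 - s) * moment p a + s * a x.
  move=> ca; have sumE (N : nat) (v : 'I_N -> R) (z : 'I_N -> T) :
      (\sum_i v i *: coords (z i)) 0 c = \sum_i v i * a (z i).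
    by rewrite summxE; apply: eq_bigr => i _; rewrite mxE ca.
  have /rowP/(_ c) := w'E; rewrite !sumE [in RHS]big_ord_recl.
  have -> : y ord0 = x by rewrite /y unlift_none.
  have -> : w ord0 = s by rewrite /w unlift_none.
  have -> : moment q a = \sum_i w' i * a (y (lift j0 i)).
    by apply: eq_bigr => j _; rewrite !mxE.
  move=> ->; rewrite addrC; congr (_ + _); rewrite /moment big_distrr.
  by apply: eq_bigr => j _; rewrite /w /y liftK /= mulrA.
have q1 : moment q (cst 1) <= 1.
  rewrite (momentE ord0) => [|z]; last by rewrite mxE unlift_none.
  move: p1; rewrite /= /cst; nra.
exists q; last first.
  split=> [|i].
    by apply: (momentE (lift ord0 ord0)) => z; rewrite mxE liftK unlift_none.
  by apply: (momentE (lift ord0 (lift ord0 i))) => z; rewrite mxE !liftK.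
split=> //; split=> j; rewrite mxE //= in_itv /= w'0 /=.
apply: le_trans q1; rewrite /moment (bigD1 j) //= mxE /= /cst mulr1 lerDl.
by rewrite sumr_ge0 // => k _; rewrite mxE mulr1.
Qed.

(** Moves [p] towards the zero measure, which is what forces [c <= 0] in the duality proof. *)
Let K_shrink (p : ('rV[T]_m.+2 * 'rV[R]_m.+2)%type) (s : R) : K p -> 0 < s -> s <= 1 ->
  exists2 q, K q & forall a, moment q a = (1 - s) * moment p a.
Proof.
move=> [[pA pw] p1] s0 s1.
pose q : ('rV[T]_m.+2 * 'rV[R]_m.+2)%type := (p.1, (1 - s) *: p.2).
have qE a : moment q a = (1 - s) * moment p a.
  by rewrite /moment [RHS]big_distrr; apply: eq_bigr => j _; rewrite /= mxE mulrA.
exists q => //; split; last first.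
  rewrite /= qE; move: p1 => /= p1.
  have : 0 <= moment p (cst 1).
    apply: sumr_ge0 => j _; have := pw j.
    by rewrite /= in_itv /= mulr1 => /andP[].
  nra.
split=> //= j; have := pw j; rewrite mxE /= !in_itv /= => /andP[H0 H1].
by apply/andP; split; nra.
Qed.

(** The first hypothesis is what feasibility of the primal provides: integrate the inequality
    against a measure of mass at most [1], and use [c <= 0]. *)
Lemma atomic_strong_duality :
  (forall (u : 'I_m -> R) (c : R), c <= 0 ->
     (forall x, A x -> c <= \sum_i u i * f i x) -> c <= \sum_i u i * b i) ->
  (forall (y : 'I_m -> R) (s : R), 0 <= s ->
     (forall x, A x -> 0 <= f0 x - \sum_i y i * f i x + s) ->
     \sum_i y i * b i - s <= D) ->
  exists (x : 'I_m.+2 -> T) (w : 'I_m.+2 -> R),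
    [/\ forall j, A (x j), forall j, 0 <= w j, \sum_j w j <= 1,
        forall i, \sum_j w j * f i (x j) = b i & \sum_j w j * f0 (x j) <= D].
Proof.
move=> feas opt.
(* If the squared distance [g] from the moments to the target half-line does not
   vanish at its minimum [p], the first-order condition at [p] is a hyperplane
   [(u0, u)] separating them. It is vertical ([u0 = 0]) only if the primal is
   infeasible; otherwise it is a dual solution of value greater than [D]. *)
pose pos (z : R) : R := Num.max 0 (z - D).
pose g p : R := pos (moment p f0) ^+ 2 + \sum_i (moment p (f i) - b i) ^+ 2.
have g_cont : continuous g.
  move=> p.
  have cpos : {for p, continuous (fun q => pos (moment q f0))}.
    apply: (@continuous_max R _ (cst 0) (fun q => moment q f0 - D)).
      exact: cst_continuous.
    by apply: (@continuousB R _ _ (moment^~ f0) (cst D));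
      [exact: moment_continuous|exact: cst_continuous].
  have csum : {for p, continuous (fun q => \sum_i (moment q (f i) - b i) ^+ 2)}.
    apply: sum_continuous => i q.
    have ci : {for q, continuous (fun q => moment q (f i) - b i)}.
      by apply: (@continuousB R _ _ (moment^~ (f i)) (cst (b i)));
        [exact: moment_continuous|exact: cst_continuous].
    exact: (continuousM ci ci).
  exact: (continuousD (continuousM cpos cpos) csum).
have [p] := compact_EVT_min K_neq0 K_compact (continuous_subspaceT g_cont).
rewrite inE => Kp p_min.
pose u0 := pos (moment p f0); pose u i := moment p (f i) - b i.
have u00 : 0 <= u0 by rewrite /u0 /pos le_max lexx.
pose c := u0 * moment p f0 + \sum_i u i * moment p (f i).
(* Along the segment from [p], [g] is at most a quadratic in [s] with value [g p] at [s = 0];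
   minimality makes its linear coefficient nonnegative. *)
have first_order e0 (e : 'I_m -> R) :
    (forall s, 0 < s -> s <= 1 -> exists2 q, K q &
       moment q f0 = (1 - s) * moment p f0 + s * e0 /\
       forall i, moment q (f i) = (1 - s) * moment p (f i) + s * e i) ->
    c <= u0 * e0 + \sum_i u i * e i.
  move=> H; rewrite -subr_ge0.
  pose d0 := e0 - moment p f0; pose d i := e i - moment p (f i).
  apply: (@ge0_of_quadratic _ _ (d0 ^+ 2 + \sum_i d i ^+ 2)).
    by rewrite addr_ge0 ?sqr_ge0 // sumr_ge0 // => i _; rewrite sqr_ge0.
  move=> s s0 s1; have [q Kq [q0 qi]] := H s s0 s1.
  have : g q <= (u0 + s * d0) ^+ 2 + \sum_i (u i + s * d i) ^+ 2.
    apply: lerD; last by apply: ler_sum => i _; rewrite qi /u /d; nra.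
    rewrite q0 /u0 /pos /d0; set z := moment p f0.
    have -> : s * (e0 - z) = ((1 - s) * z + s * e0 - D) - (z - D) by ring.
    exact: sqr_max0_le.
  move/(le_trans (p_min _ (mem_set Kq))).
  rewrite {1}/g -/u0 -subr_ge0 => {}H.
  apply: le_trans H _; rewrite le_eqVlt; apply/orP; left; apply/eqP.
  have -> : \sum_i (u i + s * d i) ^+ 2 =
      \sum_i u i ^+ 2 + 2 * s * (\sum_i u i * d i) + s ^+ 2 * \sum_i d i ^+ 2.
    by rewrite !big_distrr /= -!big_split; apply: eq_bigr => i _ /=; ring.
  have -> : u0 * e0 + \sum_i u i * e i - c = u0 * d0 + \sum_i u i * d i.
    rewrite /c opprD addrACA -mulrBr -sumrB; congr (_ + _).
    by apply: eq_bigr => i _; rewrite mulrBr.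
  rewrite (_ : \sum_i (moment p (f i) - b i) ^+ 2 = \sum_i u i ^+ 2) //.
  ring.
have cA x : A x -> c <= u0 * f0 x + \sum_i u i * f i x.
  by move=> Ax; apply: first_order => s s0 s1; exact: K_segment.
have c0 : c <= 0.
  have := first_order 0 (fun=> 0); rewrite mulr0 big1 ?addr0; last first.
    by move=> i _; rewrite mulr0.
  apply=> s s0 s1; have [q Kq qE] := K_shrink Kp s0 s1.
  by exists q => //; split=> [|i]; rewrite qE mulr0 addr0.
(* The hyperplane misses the target [(D, b)] by exactly [g p], because
   [pos z * (z - D) = pos z ^+ 2]. *)
have cE : c = u0 * D + \sum_i u i * b i + g p.
  rewrite /c /g -/u0 addrACA -big_split /=; congr (_ + _).
    rewrite /u0 /pos; case: (leP 0 (moment p f0 - D)) => _; ring.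
  by apply: eq_bigr => i _; rewrite /u; ring.
have gp0 : g p <= 0.
  rewrite leNgt; apply/negP => gp.
  have [u0E|u0N] := eqVneq u0 0.
    have := feas u c c0; rewrite cE u0E mul0r add0r => H.
    suff : \sum_i u i * b i + g p <= \sum_i u i * b i by lra.
    by apply: H => x /cA; rewrite cE u0E !mul0r !add0r.
  have u0P : 0 < u0 by rewrite lt_def u0N.
  have := opt (fun i => - u i / u0) (- c / u0).
  rewrite divr_ge0 ?oppr_ge0 // => /(_ isT).
  have sumE (F : 'I_m -> R) : \sum_i - u i / u0 * F i = - (\sum_i u i * F i) / u0.
    rewrite -sumrN big_distrl; apply: eq_bigr => i _ /=.
    by rewrite -mulrA [_^-1 * _]mulrC mulrA mulNr.
  rewrite sumE => H.
  have : - (\sum_i u i * b i) / u0 - - c / u0 <= D.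
    apply: H => x Ax; rewrite sumE.
    have -> : f0 x - - (\sum_i u i * f i x) / u0 + - c / u0 =
      (u0 * f0 x + \sum_i u i * f i x - c) / u0 by field.
    by rewrite divr_ge0 // subr_ge0 cA.
  rewrite -mulrBl ler_pdivrMr // cE; lra.
have [sq0 sqi] : pos (moment p f0) ^+ 2 <= 0 /\
    forall i, (moment p (f i) - b i) ^+ 2 <= 0.
  have s0 : 0 <= \sum_i (moment p (f i) - b i) ^+ 2.
    by apply: sumr_ge0 => i _; rewrite sqr_ge0.
  have := sqr_ge0 (pos (moment p f0)); rewrite /g in gp0 => h0; split=> [|i]; first lra.
  have : (moment p (f i) - b i) ^+ 2 <= \sum_i (moment p (f i) - b i) ^+ 2.
    by rewrite (bigD1 i) //= lerDl sumr_ge0 // => k _; rewrite sqr_ge0.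
  lra.
have [[pA pw] p1] := Kp.
exists (fun j => p.1 ord0 j), (fun j => p.2 ord0 j); split.
- exact: pA.
- by move=> j; have := pw j; rewrite /= in_itv /= => /andP[].
- by move: p1; rewrite /= /moment (eq_bigr _ (fun j _ => mulr1 (p.2 ord0 j))).
- move=> i; apply/eqP; rewrite -subr_eq0 -sqrf_eq0 eq_le sqi sqr_ge0 //.
have : pos (moment p f0) == 0 by rewrite -sqrf_eq0 eq_le sq0 sqr_ge0.
rewrite /pos; case: (leP 0 (_ - D)) => [_|h _]; [|by rewrite -subr_le0 ltW].
by rewrite subr_eq0 => /eqP h; rewrite -[leLHS]/(moment p f0) h.
Qed.

End AtomicDuality.

(** * Integration over the simplex *)

Lemma prod_continuous (R : realType) (T : topologicalType) (I : Type)
    (s : seq I) (P : pred I) (F : I -> T -> R) :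
  (forall i, continuous (F i)) -> continuous (fun x => \prod_(i <- s | P i) F i x).
Proof.
move=> Fc x; apply: cvg_big => [y|i _]; [exact: mul_continuous|exact: Fc].
Qed.

(** * Finitely supported measures *)

Section AtomicMeasure.
Context (d : measure_display) (T : measurableType d) (R : realType).
Variables (x : nat -> T) (w : nat -> {nonneg R}) (N : nat).

Definition atomic : set T -> \bar R :=
  msum (fun k => mscale (w k) (dirac (x k))) N.

HB.instance Definition _ := Measure.on atomic.

Lemma ge0_integral_atomic (D : set T) (g : T -> R) :
  measurable D -> measurable_fun D g -> (forall k, D (x k)) ->
  (forall y, 0 <= g y) ->
  (\int[atomic]_(y in D) (g y)%:E)%E = (\sum_(k < N) (w k)%:num * g (x k))%:E.
Proof.
move=> mD mg Dx g0.
have mg' : measurable_fun D (fun y => (g y)%:E) by exact/measurable_EFinP.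
rewrite ge0_integral_measure_sum //; last by move=> y _; rewrite /= lee_fin.
rewrite -sumEFin; apply: eq_bigr => k _.
rewrite ge0_integral_mscale //; last by move=> y _; rewrite /= lee_fin.
rewrite integral_dirac // diracE mem_set ?mul1e //.
Qed.

Lemma integral_atomic (D : set T) (g : T -> R) :
  measurable D -> measurable_fun D g -> (forall k, D (x k)) ->
  (\int[atomic]_(y in D) (g y)%:E)%E = (\sum_(k < N) (w k)%:num * g (x k))%:E.
Proof.
move=> mD mg Dx; rewrite integralE.
have -> : ((fun y => (g y)%:E)^\+)%E = EFin \o (g^\+) by rewrite funerpos.
have -> : ((fun y => (g y)%:E)^\-)%E = EFin \o (g^\-) by rewrite funerneg.
rewrite !ge0_integral_atomic //; first last.
- exact: measurable_funrpos.
- exact: measurable_funrneg.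
rewrite -EFinB -sumrB; congr (_%:E); apply: eq_bigr => k _.
by rewrite -mulrBr; congr (_ * _); rewrite -[in RHS](funrposBneg g).
Qed.
End AtomicMeasure.

Section SimplexIntegration.
Variables (R : realType) (n : nat).

Lemma peval_continuous (p : rpoly R n) : continuous (peval p : Rn R n -> R).
Proof.
rewrite (_ : peval p =
  fun x => \sum_(a <- msupp p) p@_a * \prod_i x ord0 i ^+ a i); last first.
  by apply/funext => x; rewrite /peval mevalE.
apply: sum_continuous => a x.
apply: (@continuousM R _ (cst p@_a) (fun y : Rn R n => \prod_i y ord0 i ^+ a i)).
  exact: cst_continuous.
apply: prod_continuous => i z.
apply: (@continuous_comp _ _ _ (fun y : Rn R n => y ord0 i) (fun z => z ^+ a i)).
  exact: coord_continuous.
exact: exprn_continuous.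
Qed.

Lemma continuous_measurable (g : Rn R n -> R) :
  continuous g -> measurable_fun setT (g : BorelRn R n -> R).
Proof.
move=> /continuousP cg _; apply: (measurability _ (RGenOpens.measurableE R)) => //.
move=> _ [_ [a [b ->]] <-]; rewrite setTI; apply: sub_sigma_algebra.
exact/cg/interval_open.
Qed.

Lemma peval_measurable (p : rpoly R n) :
  measurable_fun setT (peval p : BorelRn R n -> R).
Proof. by apply: continuous_measurable; exact: peval_continuous. Qed.

Local Notation Delta := (@std_simplex R n).

Lemma std_simplex_compact : compact (@std_simplex R n : set (Rn R n)).
Proof.
have -> : (@std_simplex R n : set (Rn R n)) =
    [set x : 'rV[R]_n | forall i, `[0, 1]%classic (x ord0 i)] `&`
    (fun x : 'rV[R]_n => \sum_i x ord0 i) @^-1` [set 1].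
  apply/seteqP; split=> [x [x0 x1]|x [x01 x1]]; split=> // i; last first.
    by have := x01 i; rewrite /= in_itv /= => /andP[].
  rewrite /= in_itv /= x0 /= -x1 (bigD1 i) //= lerDl sumr_ge0 // => j _; exact: x0.
apply: compact_closedI.
  by apply: (@rV_compact R n (fun=> `[0, 1]%classic)) => j; exact: segment_compact.
apply: preimage_closed; last exact: closed_eq.
move=> x _; apply: sum_continuous => i; exact: coord_continuous.
Qed.

Lemma std_simplex_measurable : measurable Delta.
Proof.
rewrite -[X in measurable X]setCK; apply: measurableC; apply: sub_sigma_algebra.
rewrite openC; apply: compact_closed; last exact: std_simplex_compact.
exact: norm_hausdorff.
Qed.

Lemma std_simplex_nonempty : (0 < n)%N -> (@std_simplex R n : set (Rn R n)) !=set0.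
Proof.
move=> n0; exists (\row_i (i == Ordinal n0)%:R); split=> [i|].
  by rewrite mxE ler0n.
under eq_bigr do rewrite mxE.
by rewrite (bigD1 (Ordinal n0)) //= big1 ?addr0 // => j /negPf ->.
Qed.

Lemma peval_integrable (mu : {measure set BorelRn R n -> \bar R}) (p : rpoly R n) :
  (mu setT < +oo)%E -> mu.-integrable Delta (EFin \o peval p).
Proof.
move=> muoo; apply: measurable_bounded_integrable.
- exact: std_simplex_measurable.
- apply: le_lt_trans muoo; apply: le_measure; rewrite ?inE //.
  exact: std_simplex_measurable.
- exact: measurable_funS (peval_measurable p).
have : compact (peval p @` (@std_simplex R n : set (Rn R n))).
  apply: continuous_compact; last exact: std_simplex_compact.
  by apply: continuous_subspaceT; exact: peval_continuous.
move=> /compact_bounded[M [Mr HM]]; exists M; split=> // y My x Dx.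
by apply: HM => //; exists x.
Qed.

End SimplexIntegration.

(** * Moment functionals of a measure *)

Lemma homogeneous_msize (R : realType) (n d : nat) (p : rpoly R n) :
  homogeneous d p -> (msize p <= d.+1)%N.
Proof.
by move=> /dhomogP hp; rewrite msizeE; apply/bigmax_leqP_seq => a ap _; rewrite ltnS hp.
Qed.

Lemma msize_monX_sumX (R : realType) (n : nat) (a : mon n) :
  (msize (monX R a * sumX R n) <= (mdeg a).+2)%N.
Proof.
rewrite -addn1; apply: homogeneous_msize; apply: dhomogM; first by rewrite dhomogX.
by apply: rpred_sum => i _; rewrite dhomogX /= mdeg1.
Qed.

Section PolynomialIntegral.
Variables (R : realType) (n : nat) (mu : {measure set BorelRn R n -> \bar R}).
Hypothesis mu_fin : (mu setT < +oo)%E.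

Local Notation Delta := (@std_simplex R n).

Definition pint (p : rpoly R n) : R := Rintegral mu Delta (peval p).

Lemma pintE p : (\int[mu]_(x in Delta) (peval p x)%:E)%E = (pint p)%:E.
Proof.
rewrite /pint /Rintegral fineK //; apply: integrable_fin_num.
  exact: std_simplex_measurable.
exact: peval_integrable.
Qed.

Lemma pintD p q : pint (p + q) = pint p + pint q.
Proof.
rewrite /pint -RintegralD; last exact: peval_integrable.
- by congr Rintegral; apply/funext => x; rewrite /peval mevalD.
- exact: std_simplex_measurable.
- exact: peval_integrable.
Qed.

Lemma pintZ c p : pint (c *: p) = c * pint p.
Proof.
rewrite /pint -RintegralZl; last exact: peval_integrable.
  by congr Rintegral; apply/funext => x; rewrite /peval mevalZ.
exact: std_simplex_measurable.
Qed.

Lemma pint_sum (I : Type) (s : seq I) (P : pred I) (F : I -> rpoly R n) :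
  pint (\sum_(i <- s | P i) F i) = \sum_(i <- s | P i) pint (F i).
Proof.
apply: (big_morph _ pintD); by rewrite -[0 in LHS](scale0r 0) pintZ mul0r.
Qed.

Lemma eq_pint p q : (forall x, Delta x -> peval p x = peval q x) -> pint p = pint q.
Proof. by move=> pq; apply: eq_Rintegral => x /set_mem; exact: pq. Qed.

Lemma le_pint p q : (forall x, Delta x -> peval p x <= peval q x) -> pint p <= pint q.
Proof.
move=> pq; apply: le_Rintegral => //; first exact: std_simplex_measurable.
  exact: peval_integrable.
exact: peval_integrable.
Qed.

Definition moments (r : nat) (a : mpoly.bmultinom n r.+1) : R :=
  pint (monX R (mpoly.bmnm a)).

(** [Lr] reads only the coefficients of degree at most [r]; the size bound ensures that these are
    all of [p]. *)
Lemma Lr_moments (r : nat) (p : rpoly R n) :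
  (msize p <= r.+1)%N -> Lr (@moments r) p = pint p.
Proof.
move=> pr; rewrite {2}(mpolywE pr) pint_sum; apply: eq_bigr => a _.
by rewrite pintZ.
Qed.

Lemma pint1E : (\int[mu]_(x in Delta) 1 = (pint (mconst n 1))%:E)%E.
Proof.
rewrite -pintE; apply: eq_integral => x _.
by rewrite /peval /mconst mevalC.
Qed.

Lemma pint_monX_ge0 (a : mon n) : 0 <= pint (monX R a).
Proof.
apply: Rintegral_ge0 => x [x0 _]; rewrite /peval mevalX.
by apply: prodr_ge0 => i _; rewrite exprn_ge0.
Qed.

Lemma pint_mul_sumX (p : rpoly R n) : pint (p * sumX R n) = pint p.
Proof.
apply: eq_pint => x [_ x1].
by rewrite {1}/peval mevalM -/(peval (sumX R n) x) peval_sumX x1 mulr1.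
Qed.

End PolynomialIntegral.

(** * The gap between the moment problem and its relaxation *)

Lemma peval_sumZ (R : realType) (n m : nat) (f : 'I_m -> rpoly R n) (u : 'I_m -> R)
    (x : Rn R n) :
  peval (\sum_i u i *: f i) x = \sum_i u i * peval (f i) x.
Proof.
by rewrite /peval raddf_sum; apply: eq_bigr => i _; exact: mevalZ.
Qed.

Theorem theorem5 (R : realType) (n m d : nat)
  (f0 : rpoly R n) (f : 'I_m -> rpoly R n) (b : 'I_m -> R)
  (ybar : 'I_m -> R) (t : R) :
  (0 < n)%N ->
  homogeneous d f0 -> (forall i, homogeneous d (f i)) ->
  let Delta := @std_simplex R n in
  (* feasible measures of the generalized moment problem *)
  let feasible (mu : {measure set BorelRn R n -> \bar R}) :=
    [/\ mu (~` Delta) = 0%E, (mu setT < +oo)%E,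
        (forall i, (\int[mu]_(x in Delta) (peval (f i) x)%:E)%E = (b i)%:E)
      & (\int[mu]_(x in Delta) 1 <= 1)%E] in
  let val := ereal_inf
    [set (\int[mu]_(x in Delta) (peval f0 x)%:E)%E | mu in feasible] in
  (exists mu, feasible mu) ->
  (* (ybar, t) is an optimal solution of the dual *)
  let dual_feasible (y : 'I_m -> R) (s : R) :=
    0 <= s /\
    (forall x, Delta x -> 0 <= peval f0 x - \sum_(i < m) y i * peval (f i) x + s) in
  dual_feasible ybar t ->
  (forall y s, dual_feasible y s ->
     \sum_(i < m) y i * b i - s <= \sum_(i < m) ybar i * b i - t) ->
  forall r : nat, (d%:R * (d%:R - 1)) / 2 + 1 < r%:R :> R ->
  (* feasible functionals L^(r) on R[x]_r of the LP relaxation *)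
  let LPfeasible (l : mpoly.bmultinom n r.+1 -> R) :=
    [/\ (forall i, Lr l (f i) = b i),
        Lr l (@mconst R n 1) <= 1,
        (forall a : mon n, (mpoly.mdeg a <= r)%N -> 0 <= Lr l (monX R a))
      & (forall a : mon n, (mpoly.mdeg a <= r - 1)%N ->
           Lr l (monX R a) = Lr l (monX R a * sumX R n))] in
  let fLP := ereal_inf [set (Lr l f0)%:E | l in LPfeasible] in
  (* sum_{i=0}^{m+1} B(y_i f_i) + t, with y_0 f_0 = f_0, y_i f_i = - ybar_i f_i
     (i in [m]) and y_{m+1} f_{m+1} = - (- t) * 1 = t (constant, degree 0) *)
  let S := Bnum d f0 + \sum_(i < m) Bnum d (- ybar i *: f i)
           + Bnum 0 (@mconst R n t) + t in
  (0 <= val - fLP <=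
     ((S * (d%:R * (d%:R - 1))) / (2 * (r%:R - 1) - d%:R * (d%:R - 1)))%:E)%E.
Proof.
move=> n0 hf0 hf Delta feasible val [mu0 feas0] dual_feasible [t0 dual_t] dual_opt
  r hr; cbv zeta.
set fLP := ereal_inf [set (Lr l f0)%:E | l in _]; set S := _ + t.
have dr := degree_le_level hr.
have r1 := level_gt0 hr.
have mD : measurable Delta := @std_simplex_measurable R n.
set D := \sum_(i < m) ybar i * b i - t in dual_opt *.
set C := _ / (_ - _).
have fLP_ge : ((D - C)%:E <= fLP)%E.
  apply/ereal_infP => _ [l [lb l1 l_ge0 l_shift] <-]; rewrite lee_fin.
  exact: (lp_lower_bound n0 hf0 hf t0 dual_t hr lb l1 l_ge0 l_shift).
have hfr (p : rpoly R n) : homogeneous d p -> (msize p <= r.+1)%N.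
  by move=> /homogeneous_msize /leq_trans; apply.
have fLP_le_val : (fLP <= val)%E.
  apply/ereal_infP => _ [mu [mu_supp mu_fin mu_b mu_1] <-].
  apply: ereal_inf_lbound; exists (@moments R n mu r); last first.
    by rewrite Lr_moments ?hfr // pintE.
  split.
  - move=> i; rewrite Lr_moments ?hfr //; apply/EFin_inj.
    by rewrite -pintE // mu_b.
  - by rewrite Lr_moments ?msize1 // -lee_fin -pint1E.
  - by move=> a ar; rewrite Lr_moments ?pint_monX_ge0 // msizeX.
  - move=> a ar.
    (* As [0 < r], the truncated [r - 1] is a true predecessor, and the product with [sumX] stays of
       degree at most [r]. *)
    have ar1 : ((mdeg a).+2 <= r.+1)%N by lia.
    have sz := leq_trans (msize_monX_sumX R a) ar1.
    by rewrite !Lr_moments ?pint_mul_sumX // msizeX ltnW.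
have val_le : (val <= D%:E)%E.
  have [mu0_supp mu0_fin mu0_b mu0_1] := feas0.
  have one_le : pint mu0 (mconst n 1) <= 1 by rewrite -lee_fin -pint1E.
  have one_ge : 0 <= pint mu0 (mconst n 1).
    by rewrite /mconst mpolyC1 -mpolyX0 pint_monX_ge0.
  have [||x [w [xD w0 w1 wb wD]]] := @atomic_strong_duality R (Rn R n) Delta m
    (peval f0) (fun i => peval (f i)) b D (@std_simplex_compact R n)
    (@std_simplex_nonempty R n n0) (@peval_continuous R n f0)
    (fun i => @peval_continuous R n (f i)).
  - move=> u c c0 cu.
    have : pint mu0 (mconst n c) <= pint mu0 (\sum_i u i *: f i).
      apply: le_pint => // z Dz; rewrite peval_sumZ /peval /mconst mevalC; exact: cu.
    have -> : mconst n c = c *: mconst n 1 :> rpoly R n.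
      by rewrite /mconst -mul_mpolyC -mpolyCM mulr1.
    rewrite pintZ // pint_sum //.
    have -> : \sum_i pint mu0 (u i *: f i) = \sum_i u i * b i.
      apply: eq_bigr => i _; rewrite pintZ //; congr (_ * _).
      by apply: EFin_inj; rewrite -pintE // mu0_b.
    nra.
  - move=> y s s0 ys; exact: dual_opt.
  (* [msum] takes a sequence indexed by [nat], hence the reading of the [m.+2] atoms through
     [inord]. *)
  pose w' k : {nonneg R} := NngNum (w0 (inord k)).
  pose mu := atomic (fun k => x (inord k) : BorelRn R n) w' m.+2.
  have muA (B : set (BorelRn R n)) : mu B =
      (\sum_(k < m.+2) (w' k)%:num%:E * dirac (x (inord k) : BorelRn R n) B)%E by [].
  have muE (g : BorelRn R n -> R) : measurable_fun Delta g ->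
      (\int[mu]_(y in Delta) (g y)%:E)%E = (\sum_j w j * g (x j))%:E.
    move=> mg; rewrite integral_atomic //.
    by congr (_%:E); apply: eq_bigr => j _; rewrite /= inord_val.
  have mp p : measurable_fun Delta (peval p : BorelRn R n -> R).
    exact: measurable_funS (peval_measurable p).
  apply: (@le_trans _ _ (\int[mu]_(y in Delta) (peval f0 y)%:E)%E); last first.
    by rewrite muE // lee_fin.
  apply: ereal_inf_lbound; exists mu => //; split.
  - rewrite [LHS]muA big1 // => k _; rewrite diracE memNset ?mule0 //.
    by apply; exact: xD.
  - by rewrite [X in (X < _)%E]muA; apply: lte_sum_pinfty => k _;
      rewrite diracE in_setT mule1 ltry.
  - by move=> i; rewrite muE // wb.
  - rewrite (muE (cst 1)) // lee_fin; move: w1.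
    by rewrite (eq_bigr (fun j => w j * cst 1 (x j))) // => j _; rewrite mulr1.
(* Both values lie between the reals [D - C] and [D], which excludes the infinite cases. *)
move: fLP_ge fLP_le_val val_le.
case: fLP => [p||] //; case: val => [v||] //; rewrite !lee_fin => H1 H2 H3.
apply/andP; split; lra.
Qed.
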